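(* For every constant number $n\ge 2$ of agents there are constants $c,C>0$ (depending only on $n$) such that for all integers $m\ge n$ there is a query-enhanced algorithm that makes at most $C\log m$ value queries per agent and, for every instance with $n$ agents and $m$ goods, computes a $\frac{c}{\sqrt{\log m}}$-EFX allocation.
   Context: There is a set $N=\{1,\dots,n\}$ of $n\ge 2$ agents and a set $G$ of $m\ge n$ goods. Each agent $i$ has a valuation function $v_i:G\to\mathbb{R}_{\ge 0}$, extended additively to bundles: $v_i(X)=\sum_{g\in X}v_i(g)$ for $X\subseteq G$. An allocation is a tuple $(X_i)_{i\in N}$ of pairwise disjoint (possibly empty) bundles with $\bigcup_{i}X_i=G$. For $\alpha\in[0,1]$, an allocation is $\alpha$-EFX if for all agents $i\ne j$ with $X_j\neq\varnothing$ and every $g\in X_j$, $v_i(X_i)\ge\alpha\cdot v_i(X_j\setminus\{g\})$. A ranking (strict linear order) $\succ_i$ of $G$ is consistent with $v_i$ if $g\succ_i g'$ implies $v_i(g)\ge v_i(g')$. An instance consists of valuations together with rankings consistent with them. A query-enhanced algorithm is a deterministic algorithm that receives as input the rankings $(\succ_i)_{i\in N}$, may (adaptively) make value queries, each of which names an agent $i$ and a good $g$ and returns $v_i(g)$, and finally outputs an allocation. The number of queries per agent is the maximum, over agents $i$, of the number of queries naming $i$. *)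

(* Defs.v *)
From HB Require Import structures.
From mathcomp Require Import all_boot all_order all_algebra.
From mathcomp Require Import reals exp.

Set Implicit Arguments.
Unset Strict Implicit.
Unset Printing Implicit Defensive.

Import Order.TTheory GRing.Theory Num.Theory.
Local Open Scope ring_scope.

(** Agents are ['I_n], goods are ['I_m]; real numbers are any [R : realType]. *)

Definition bundle_value (R : realType) (m : nat) (w : 'I_m -> R)
    (X : {set 'I_m}) : R :=
  \sum_(g in X) w g.

Record ranking (m : nat) := Ranking {
  prefers :> rel 'I_m;
  prefers_irr : irreflexive prefers;
  prefers_trans : transitive prefers;
  prefers_total : forall g h : 'I_m, g != h -> prefers g h || prefers h g }.

Definition consistent (R : realType) (m : nat) (r : ranking m)
    (w : 'I_m -> R) : Prop :=
  forall g h : 'I_m, r g h -> w h <= w g.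

Record instance (R : realType) (n m : nat) := Instance {
  valuation : 'I_n -> 'I_m -> R;
  rankings : 'I_n -> ranking m;
  valuation_ge0 : forall i g, 0 <= valuation i g;
  rankings_consistent : forall i, consistent (rankings i) (valuation i) }.

Record allocation (n m : nat) := Allocation {
  bundle :> 'I_n -> {set 'I_m};
  bundle_disjoint : forall i j, i != j -> [disjoint bundle i & bundle j];
  bundle_cover : \bigcup_(i < n) bundle i = [set: 'I_m] }.

Definition EFX (R : realType) (n m : nat) (alpha : R)
    (v : 'I_n -> 'I_m -> R) (X : allocation n m) : Prop :=
  forall i j : 'I_n, i != j -> X j != set0 ->
  forall g : 'I_m, g \in X j ->
    alpha * bundle_value (v i) (X j :\ g) <= bundle_value (v i) (X i).

(** A deterministic adaptive strategy is a decision tree: the continuation of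
    [Query i g] receives the answer v_i(g). The tree is well-founded, so every
    execution terminates, but its depth need not be bounded a priori. *)
Inductive strategy (R : realType) (n m : nat) :=
| Output of allocation n m
| Query of 'I_n & 'I_m & (R -> strategy R n m).

Fixpoint run (R : realType) (n m : nat) (v : 'I_n -> 'I_m -> R)
    (s : strategy R n m) : allocation n m :=
  match s with
  | Output X => X
  | Query i g k => run v (k (v i g))
  end.

(** Repeated queries for the same value are counted with multiplicity. *)
Fixpoint num_queries (R : realType) (n m : nat) (v : 'I_n -> 'I_m -> R)
    (a : 'I_n) (s : strategy R n m) : nat :=
  match s with
  | Output _ => 0
  | Query i g k => ((i == a) + num_queries v a (k (v i g)))%N
  end.

Definition algorithm (R : realType) (n m : nat) : Type :=
  ('I_n -> ranking m) -> strategy R n m.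

Definition outcome (R : realType) (n m : nat) (A : algorithm R n m)
    (I : instance R n m) : allocation n m :=
  run (@valuation R n m I) (A (@rankings R n m I)).

Definition queries_per_agent (R : realType) (n m : nat) (A : algorithm R n m)
    (I : instance R n m) : nat :=
  \max_(i < n) num_queries (@valuation R n m I) i (A (@rankings R n m I)).

(* Main.v *)
Require Import Defs.
From HB Require Import structures.
From mathcomp Require Import all_boot all_order all_algebra.
From mathcomp Require Import boolp reals exp.
From mathcomp Require Import lra.

Set Implicit Arguments.
Unset Strict Implicit.
Unset Printing Implicit Defensive.

Import Order.TTheory GRing.Theory Num.Theory.
Local Open Scope ring_scope.

(** Every agent is asked for the values of her goods of rank below [n] and of
    rank [n 2^k]. By Cauchy condensation the latter determine, up to a constant
    factor and an error of [n] times her [n]-th value, the total value of her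
    goods of rank at least [n]. As long as some remaining agent values her best
    remaining good at a constant fraction of this estimate, she leaves with that
    good alone: nobody EFX-envies a singleton, and the good is worth a constant
    fraction of everything left. When no such agent remains, the best good is
    small for everybody, and round robin on the rest gives every agent a constant
    fraction of its value, since it loses only one good per agent. At most [n - 1]
    goods were removed before, so the estimates made for the full set of goods
    stay valid. The resulting factor [1 / (9 n)] does not depend on [m]. *)

(** * Ranks of goods, and values listed by rank *)

Section Rank.
Variables (m : nat) (r : ranking m).
Implicit Types (g h : 'I_m) (S : {set 'I_m}).

Definition rank g : nat := #|[set h | r h g]|.

Lemma rank_lt g h : r g h -> (rank g < rank h)%N.
Proof.
move=> rgh; apply: proper_card; apply/properP; split.
  by apply/subsetP => k; rewrite !inE => /prefers_trans; apply.
by exists g; rewrite !inE ?rgh ?prefers_irr.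
Qed.

Lemma rank_inj : injective rank.
Proof.
move=> g h eq_gh; apply/eqP/negPn/negP => /(prefers_total r) /orP[] /rank_lt;
  by rewrite eq_gh ltnn.
Qed.

Lemma rank_ltm g : (rank g < m)%N.
Proof.
rewrite -[X in (_ < X)%N]card_ord; apply: proper_card.
by apply/properP; split; [apply/subsetP | exists g; rewrite ?inE ?prefers_irr].
Qed.

Lemma rank_surj p : (p < m)%N -> exists g, rank g = p.
Proof.
move=> lt_pm; have inj : injective (fun g => Ordinal (rank_ltm g)).
  by move=> g h [/rank_inj].
have /codomP[g /(congr1 val) /= ->] := injF_onto inj (Ordinal lt_pm).
by exists g.
Qed.

Lemma card_rank_lt n : (#|[set g | (rank g < n)%N]| <= n)%N.
Proof.
rewrite cardE -(size_map rank) -[X in (_ <= X)%N](size_iota 0).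
apply: uniq_leq_size.
  by rewrite map_inj_uniq ?enum_uniq //; apply: rank_inj.
by move=> p /mapP[g]; rewrite mem_enum inE mem_iota => lt_gn ->.
Qed.

Lemma exists_top S : S != set0 ->
  exists2 g, g \in S & forall h, h \in S -> (rank g <= rank h)%N.
Proof. by case/set0Pn => g0 g0S; case: (arg_minnP rank g0S) => g; exists g. Qed.

(** Every good preferred to [g] lies outside [S]. So as long as fewer than [n] goods are gone, the
    best remaining good has rank below [n] and its value has been queried. *)
Lemma rank_top S g : (forall h, h \in S -> (rank g <= rank h)%N) ->
  (rank g <= #|~: S|)%N.
Proof.
move=> gmin; apply: subset_leq_card; apply/subsetP => h; rewrite !inE => rhg.
by apply/negP => /gmin; rewrite leqNgt rank_lt.
Qed.

Section Values.
Variables (R : realType) (w : 'I_m -> R).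

(** Writing the value as a sum gives 0 at ranks from [m] on, so the sequence is defined on all of
    [nat]; [n * 2 ^ k] may exceed [m]. *)
Definition value_at (p : nat) : R := \sum_(g | rank g == p) w g.

Lemma value_at_rank g : value_at (rank g) = w g.
Proof.
rewrite /value_at (big_pred1 g) // => h.
by apply/eqP/eqP => [/rank_inj|->].
Qed.

Lemma value_at_gem p : (m <= p)%N -> value_at p = 0.
Proof.
move=> le_mp; rewrite /value_at big_pred0 // => g.
by apply/negP => /eqP eq_gp; have := rank_ltm g; rewrite eq_gp ltnNge le_mp.
Qed.

Lemma sum_value_at a b :
  \sum_(a <= p < b) value_at p = \sum_(g | (a <= rank g < b)%N) w g.
Proof.
under eq_bigr do rewrite /value_at big_mkcond /=.
rewrite exchange_big /= [RHS]big_mkcond; apply: eq_bigr => g _.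
rewrite -big_mkcond /= -(big_nat1_eq +%R (fun=> w g)).
by apply: eq_bigl => p; rewrite eq_sym.
Qed.

Hypothesis w_cons : consistent r w.

Lemma consistent_rank g h : (rank g <= rank h)%N -> w h <= w g.
Proof.
move=> le_gh; have [->//|/(prefers_total r)/orP[/w_cons//|/rank_lt]] := eqVneq g h.
by rewrite ltnNge le_gh.
Qed.

Hypothesis w_ge0 : forall g, 0 <= w g.

Lemma value_at_ge0 p : 0 <= value_at p.
Proof. exact: sumr_ge0. Qed.

Lemma value_at_nincr p q : (p <= q)%N -> value_at q <= value_at p.
Proof.
move=> le_pq; have [lt_qm|/value_at_gem->] := ltnP q m; last exact: value_at_ge0.
have [h hq] := rank_surj lt_qm; have [g gp] := rank_surj (leq_ltn_trans le_pq lt_qm).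
by rewrite -hq -gp !value_at_rank consistent_rank // gp hq.
Qed.

End Values.
End Rank.

(* Cauchy condensation on the blocks [n 2^k, n 2^(k+1)). *)
Definition condensed (R : realType) (f : nat -> R) (n K : nat) : R :=
  \sum_(k < K) (n * 2 ^ k)%:R * f (n * 2 ^ k)%N.

Section Condensation.
Variables (R : realType) (f : nat -> R).
Hypothesis f_nincr : forall p q, (p <= q)%N -> f q <= f p.

Lemma sum_nat_le a b : \sum_(a <= p < b) f p <= (b - a)%:R * f a.
Proof.
rewrite mulr_natl -sumr_const_nat; apply: ler_sum_nat => p /andP[le_ap _].
exact: f_nincr.
Qed.

Lemma sum_nat_ge a b : (b - a)%:R * f b <= \sum_(a <= p < b) f p.
Proof.
rewrite mulr_natl -sumr_const_nat; apply: ler_sum_nat => p /andP[_ lt_pb].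
exact/f_nincr/ltnW.
Qed.

Variable n : nat.

Let block_le k : (n * 2 ^ k <= n * 2 ^ k.+1)%N.
Proof. by rewrite leq_mul2l leq_exp2l // leqnSn orbT. Qed.

Let start_le k : (n <= n * 2 ^ k)%N.
Proof. by rewrite leq_pmulr // expn_gt0. Qed.

Let block_size k : (n * 2 ^ k.+1 - n * 2 ^ k)%N = (n * 2 ^ k)%N.
Proof. by rewrite expnS mul2n -addnn mulnDr addnK. Qed.

Lemma condensed_ge K : \sum_(n <= p < n * 2 ^ K) f p <= condensed f n K.
Proof.
elim: K => [|K IH]; first by rewrite muln1 big_geq // /condensed big_ord0.
rewrite /condensed big_ord_recr (big_cat_nat (start_le K) (block_le K)) /=.
by apply: lerD => //; rewrite -[X in X%:R * _]block_size sum_nat_le.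
Qed.

(** A block is worth at least its length times the value at its end, and that length is half the
    next weight, hence the factor 2. No block precedes the first term, which stays as
    [n%:R * f n]. *)
Lemma condensed_le K :
  condensed f n K.+1 <= n%:R * f n + 2 * \sum_(n <= p < n * 2 ^ K) f p.
Proof.
elim: K => [|K IH].
  by rewrite /condensed big_ord_recr big_ord0 /= muln1 big_geq // mulr0 addr0 add0r.
rewrite /condensed big_ord_recr (big_cat_nat (start_le K) (block_le K)) /=.
have := sum_nat_ge (n * 2 ^ K) (n * 2 ^ K.+1); rewrite block_size => ge_blk.
rewrite mulrDr addrA; apply: lerD => //.
by rewrite {1}expnS mulnCA natrM -mulrA ler_pM2l ?ltr0n.
Qed.

End Condensation.

(** * Drafting: single goods first, then round robin *)

Section Draft.
Variables (R : realType) (n m : nat) (r : 'I_n -> ranking m).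
Implicit Types (S : {set 'I_m}) (s : seq 'I_n) (owner : 'I_m -> 'I_n).

Definition top (i : 'I_n) S g :=
  g \in S /\ forall h, h \in S -> (rank (r i) g <= rank (r i) h)%N.

(* The distance [index i s] of agent [i] to the head of the round-robin queue
   is what makes an induction over single picks possible. *)
Lemma round_robin s S : s != [::] -> uniq s ->
  exists2 owner, (forall g, g \in S -> owner g \in s) &
    forall i, i \in s -> forall w : 'I_m -> R, consistent (r i) w ->
    (forall g, 0 <= w g) -> forall M, 0 <= M -> (forall g, g \in S -> w g <= M) ->
    \sum_(g in S) w g <=
      (size s)%:R * \sum_(g in S | owner g == i) w g + (index i s)%:R * M.
Proof.
have [k] := ubnP #|S|; elim: k => // k IH in s S * => leSk.
case: s => // x s _ xs_uniq.
have [->|S_neq0] := eqVneq S set0.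
  exists (fun=> x) => [g|i _ w _ _ M M0 _]; first by rewrite inE.
  by rewrite big_set0 big1 ?mulr0 ?add0r ?mulr_ge0 // => g; rewrite inE.
have [g gS gtop] := exists_top (r x) S_neq0.
(* The head [x] picks [g] and moves to the end of the queue. *)
have [|||owner own_s own] := IH (rcons s x) (S :\ g).
- by rewrite (cardsD1 g S) gS in leSk.
- by case: (s).
- by rewrite rcons_uniq.
pose own' h := if h == g then x else owner h; exists own'.
  move=> h hS; rewrite /own'; have [_|neq_hg] := eqVneq; first exact: mem_head.
  by rewrite -mem_rcons own_s // !inE neq_hg.
move=> i i_s w w_cons w0 M M0 wM; rewrite (big_setD1 g gS) /=.
have i_rot : i \in rcons s x by rewrite mem_rcons.
have own'E : \sum_(h in S :\ g | own' h == i) w h =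
             \sum_(h in S :\ g | owner h == i) w h.
  apply: eq_bigl => h; rewrite /own' !inE; by have [|//] := eqVneq h g.
have {}own := own i i_rot w w_cons w0; move: own xs_uniq => /=.
rewrite size_rcons -cats1 index_cat (eq_sym x) => own /andP[x_s _].
have [eq_ix|neq_ix] := eqVneq i x.
  subst i; rewrite (negPf x_s) /= eqxx addn0 in own.
  have -> : \sum_(h in S | own' h == x) w h =
            w g + \sum_(h in S :\ g | owner h == x) w h.
    rewrite (bigD1 g) /=; last by rewrite gS /own' !eqxx.
    congr (_ + _); rewrite -own'E; apply: eq_bigl => h.
    by rewrite !inE andbC andbA.
  (* The bound [M] becomes [w g]: [x] now has index [size s], which costs [size s] times [w g].
     Owning [g] contributes [(size s).+1] times [w g], which pays for this and for [g] itself. *)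
  have/(own (w g) (w0 g)) : forall h, h \in S :\ g -> w h <= w g.
    by move=> h /setD1P[_ /gtop]; exact: consistent_rank.
  rewrite mul0r addr0 mulrDr -natr1 mulrDl mul1r; lra.
have i_s' : i \in s by move: i_s; rewrite inE (negPf neq_ix).
have -> : \sum_(h in S | own' h == i) w h =
          \sum_(h in S :\ g | owner h == i) w h.
  rewrite -own'E; apply: eq_bigl => h; rewrite !inE /own'.
  by have [_|//] := eqVneq h g; rewrite (eq_sym x) (negPf neq_ix) andbF.
(* For the other agents [g] costs at most [M], and their index drops by one. *)
have/(own M M0) : forall h, h \in S :\ g -> w h <= M.
  by move=> h /setD1P[_]; exact: wM.
have := wM g gS; rewrite i_s' -natr1 mulrDl mul1r; lra.
Qed.

Definition queried_ranks : seq nat :=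
  iota 0 n ++ [seq (n * 2 ^ k)%N | k <- iota 0 (trunc_log 2 m).+1].

Definition tail_estimate i (u : 'I_m -> R) : R :=
  condensed (value_at (r i) u) n (trunc_log 2 m).+1.

(** Here [u] stands for the recorded answers and [w] for the true valuation. Off the queried ranks
    [u] is arbitrary, so a choice made from [u] has to be justified for every compatible [w]. *)
Definition compatible i (u w : 'I_m -> R) :=
  [/\ consistent (r i) w, forall g, 0 <= w g &
      forall g, rank (r i) g \in queried_ranks -> u g = w g].

Lemma tail_estimateE i u w : compatible i u w ->
  tail_estimate i u = tail_estimate i w.
Proof.
case=> _ _ uw; apply: eq_bigr => k _; congr (_ * _).
apply: eq_bigr => g /eqP gk; apply: uw.
rewrite gk mem_cat; apply/orP; right; apply/mapP; exists (val k) => //.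
by rewrite mem_iota /=.
Qed.

(** The set [S] and the set [T] of goods of rank at least [n] differ by at most [n] goods in each
    direction, each worth at most [w g]. Condensation compares [T] with the estimate; the 3 is one
    [n%:R * w g] from its first term and twice the one lost in [T :\: S]. *)
Lemma top_estimate i u w S g : (0 < n)%N -> compatible i u w ->
  top i S g -> (#|~: S| < n)%N ->
  [/\ u g = w g,
     \sum_(h in S) w h <= n%:R * w g + tail_estimate i u &
     tail_estimate i u <= 3 * n%:R * w g + 2 * \sum_(h in S) w h].
Proof.
move=> n_gt0 cuw [gS gtop] ltSn; have [w_cons w0 uw] := cuw.
have lt_gn : (rank (r i) g < n)%N by apply: leq_ltn_trans (rank_top gtop) ltSn.
have w_le h : (rank (r i) g <= rank (r i) h)%N -> w h <= w g.
  exact: consistent_rank.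
have sum_le (B : {set 'I_m}) : (#|B| <= n)%N ->
    (forall h, h \in B -> w h <= w g) -> \sum_(h in B) w h <= n%:R * w g.
  move=> leBn wB; apply: (@le_trans _ _ (\sum_(h in B) w g)).
    exact: ler_sum.
  by rewrite sumr_const -[leLHS]mulr_natl ler_wpM2r // ler_nat.
pose T := [set h | (n <= rank (r i) h)%N].
have TE K : (m <= n * 2 ^ K)%N -> \sum_(h in T) w h =
    \sum_(n <= p < n * 2 ^ K) value_at (r i) w p.
  move=> leK; rewrite sum_value_at; apply: eq_bigl => h; rewrite inE.
  by rewrite (leq_trans (rank_ltm _ h) leK) andbT.
(* The blocks reach past the last rank, so they cover [T]. *)
have leK : (m <= n * 2 ^ (trunc_log 2 m).+1)%N.
  exact: leq_trans (ltnW (trunc_log_ltn m (isT : (1 < 2)%N))) (leq_pmull _ n_gt0).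
have nincr := value_at_nincr w_cons w0.
have card_low : (#|S :\: T| <= n)%N.
  apply: leq_trans (card_rank_lt (r i) n); apply: subset_leq_card.
  by apply/subsetP => h; rewrite !inE -ltnNge => /andP[].
have card_tail : (#|T :\: S| <= n)%N.
  apply: leq_trans (ltnW ltSn); apply: subset_leq_card.
  by apply/subsetP => h; rewrite !inE => /andP[].
have low : \sum_(h in S :\: T) w h <= n%:R * w g.
  by apply: sum_le => // h /setDP[/gtop/w_le].
have tail : \sum_(h in T :\: S) w h <= n%:R * w g.
  apply: sum_le => // h; rewrite !inE => /andP[_ le_nh].
  exact/w_le/ltnW/(leq_trans lt_gn).
have sumS : \sum_(h in S) w h = \sum_(h in S :&: T) w h + \sum_(h in S :\: T) w h.
  exact: big_setID.
have sumT : \sum_(h in T) w h = \sum_(h in S :&: T) w h + \sum_(h in T :\: S) w h.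
  by rewrite setIC; exact: big_setID.
have low0 : 0 <= \sum_(h in S :\: T) w h by exact: sumr_ge0.
have tail0 : 0 <= \sum_(h in T :\: S) w h by exact: sumr_ge0.
rewrite (tail_estimateE cuw); split.
- by apply: uw; rewrite mem_cat mem_iota lt_gn.
- have := condensed_ge nincr n (trunc_log 2 m).+1; rewrite -TE // -/(tail_estimate i w).
  lra.
- have := condensed_le nincr n (trunc_log 2 m); rewrite -/(tail_estimate i w).
  have : value_at (r i) w n <= w g.
    by rewrite -(value_at_rank (r i)) nincr // ltnW.
  move=> /(ler_wpM2l (ler0n R n)).
  have : \sum_(n <= p < n * 2 ^ trunc_log 2 m) value_at (r i) w p <= \sum_(h in T) w h.
    rewrite sum_value_at [leLHS]big_mkcond [leRHS]big_mkcond; apply: ler_sum => h _.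
    by rewrite inE; case: (n <= _)%N => //=; case: ifP.
  lra.
Qed.

(** Each removal takes away one agent and one good, which preserves [size s + #|~: S| <= n]; hence
    fewer than [n] goods are missing while agents remain. The owner is chosen before [w], from
    rankings and answers alone. *)
Lemma draft (u : 'I_n -> 'I_m -> R) s S :
  s != [::] -> uniq s -> (size s + #|~: S| <= n)%N ->
  exists2 owner, (forall g, g \in S -> owner g \in s) &
    forall i j, i \in s -> j \in s -> i != j ->
    (#|[set g in S | owner g == j]| <= 1)%N \/
    forall w, compatible i (u i) w ->
      \sum_(g in S | owner g == j) w g <=
        9 * n%:R * \sum_(g in S | owner g == i) w g.
Proof.
have [k] := ubnP (size s); elim: k => // k IH in s S *.
move=> lesk s_neq0 s_uniq les; have s_gt0 : (0 < size s)%N by case: (s) s_neq0.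
have ltSn : (#|~: S| < n)%N by apply: leq_trans les; rewrite -add1n leq_add2r.
have n_gt0 : (0 < n)%N by apply: leq_ltn_trans ltSn.
have sumj_le owner j (w : 'I_m -> R) : (forall g, 0 <= w g) ->
    \sum_(g in S | owner g == j :> 'I_n) w g <= \sum_(g in S) w g.
  move=> w0; rewrite [leLHS]big_mkcond [leRHS]big_mkcond /=; apply: ler_sum => h _.
  by case: (h \in S) => //=; case: ifP.
(* The threshold [8 * n] leaves room for both cases: it gives the factor [8 * n + n] to an agent
   leaving with [g], and exceeds the [3 * n] of [top_estimate] when nobody leaves. *)
have [[i [g [i_s gtop big_g]]]|no_big] := pselect (exists i g,
    [/\ i \in s, top i S g & tail_estimate i (u i) <= 8 * n%:R * u i g]).
  have gS := gtop.1.
  (* A last agent takes all of [S]; there is no pair left to compare. *)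
  have [s1|s'_neq0] := eqVneq (rem i s) [::].
    exists (fun=> i) => // i1 i2 i1s i2s; have := size_rem i_s.
    rewrite s1 /=; case: (s) i_s i1s i2s s_gt0 => // a [|//] _.
    by rewrite !inE => /eqP-> /eqP->; rewrite eqxx.
  have [||||owner own_s own] := IH (rem i s) (S :\ g) => //.
  - by rewrite size_rem //; case: (size s) s_gt0 lesk.
  - exact: rem_uniq.
  - by rewrite setCD setUC cardsU1 inE gS add1n size_rem // addnS -addSn prednK.
  pose own' h := if h == g then i else owner h; exists own'.
    move=> h hS; rewrite /own'; have [//|neq_hg] := eqVneq.
    by apply: mem_rem (own_s h _); rewrite !inE neq_hg.
  have own'i h : (h \in S) && (own' h == i) = (h == g).
    rewrite /own'; have [->|neq_hg] := eqVneq h g; first by rewrite gS eqxx.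
    apply/negP => /andP[hS /eqP hi]; have := own_s h.
    by rewrite !inE neq_hg hi mem_rem_uniq // !inE eqxx => /(_ hS).
  have own'j j h : j != i ->
      (h \in S) && (own' h == j) = (h \in S :\ g) && (owner h == j).
    move=> ji; rewrite /own' !inE; have [_|//] := eqVneq h g.
    by rewrite eq_sym (negPf ji) andbF.
  move=> i1 i2 i1s i2s i12.
  have [i2i|i2i] := eqVneq i2 i.
    left; rewrite (_ : [set h in S | own' h == i2] = [set g]) ?cards1 //.
    by apply/setP => h; rewrite !inE i2i own'i.
  (* The leaving agent compares [g] with all of [S], which bounds every later bundle. *)
  have [i1i|i1i] := eqVneq i1 i.
    right => w cw; subst i1; rewrite (eq_bigl _ _ own'i) big_pred1_eq.
    have [uw le_w _] := top_estimate n_gt0 cw gtop ltSn.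
    apply: le_trans (sumj_le _ _ _ _) _; first by case: cw.
    rewrite uw in big_g; lra.
  have [||//|le1|le] := own i1 i2.
  - by rewrite mem_rem_uniq // !inE i1i.
  - by rewrite mem_rem_uniq // !inE i2i.
  - left; rewrite (_ : [set h in S | own' h == i2] =
                       [set h in S :\ g | owner h == i2]) //.
    by apply/setP => h; rewrite inE own'j // inE.
  - right => w cw; rewrite (eq_bigl _ _ (fun h => own'j _ h i1i)).
    by rewrite (eq_bigl _ _ (fun h => own'j _ h i2i)); exact: le.
have [owner own_s own] := round_robin S s_neq0 s_uniq; exists owner => //.
move=> i j i_s j_s _; right => w cw; have [w_cons w0 _] := cw.
apply: le_trans (sumj_le _ _ _ w0) _.
have [->|S_neq0] := eqVneq S set0.
  rewrite big_set0 mulr_ge0 // ?sumr_ge0 // mulr_ge0 //.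
have [g gS gtop] := exists_top (r i) S_neq0.
have [uw _ le_est] := top_estimate n_gt0 cw (conj gS gtop) ltSn.
(* With [le_est] this gives [5 * n * w g] below twice the value of [S]. The round-robin loss, at
   most [n * w g], is then less than two fifths of that value, and the share of [i] times
   [5 / 3 * n] covers [S]. *)
have small : 8 * n%:R * u i g < tail_estimate i (u i).
  by rewrite ltNge; apply/negP => big_g; apply: no_big; exists i, g.
have le_sz : (size s)%:R <= n%:R :> R.
  by rewrite ler_nat (leq_trans _ les) // leq_addr.
have le_ix : (index i s)%:R <= n%:R :> R.
  by rewrite (le_trans _ le_sz) // ler_nat index_size.
have := own i i_s w w_cons w0 (w g) (w0 g) _.
have bnd h : h \in S -> w h <= w g by move/gtop; exact: consistent_rank.
move=> /(_ bnd).
have := ler_wpM2r (w0 g) le_ix.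
have share0 : 0 <= \sum_(h in S | owner h == i) w h by exact: sumr_ge0.
have := ler_wpM2r share0 le_sz.
have : 0 <= n%:R * \sum_(h in S | owner h == i) w h by rewrite mulr_ge0.
rewrite uw in small; lra.
Qed.

End Draft.

(** * Strategies whose queries are fixed in advance *)

Section Queries.
Variables (R : realType) (n m : nat).
Implicit Types (L : seq ('I_n * 'I_m)) (v : 'I_n -> 'I_m -> R).

(** The answers are collected in a table passed to [out], with default 0 where nothing is asked. *)
Fixpoint query_all L (out : ('I_n -> 'I_m -> R) -> allocation n m) :
    strategy R n m :=
  if L is (i, g) :: L' then
    Query i g (fun x => query_all L' (fun u =>
      out (fun j h => if (j, h) == (i, g) then x else u j h)))
  else Output R (out (fun _ _ => 0)).

Lemma run_query_all v L out : exists2 u, run v (query_all L out) = out u &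
  forall i g, (i, g) \in L -> u i g = v i g.
Proof.
elim: L => [|[i g] L IH] /= in out *; first by exists (fun _ _ => 0).
have [u -> uv] := IH (fun u =>
  out (fun j h => if (j, h) == (i, g) then v i g else u j h)).
eexists; first by [].
by move=> j h /=; rewrite inE; case: eqP => [[-> ->]|_ /uv].
Qed.

Lemma num_queries_query_all v a L out :
  num_queries v a (query_all L out) = count (fun p => p.1 == a) L.
Proof. by elim: L => [|[i g] L IH] //= in out *; rewrite IH. Qed.

End Queries.

(** * From answers to an allocation *)

Section Algorithm.
Variables (n m : nat) (r : 'I_n -> ranking m).

Definition queried_pairs : seq ('I_n * 'I_m) :=
  [seq p <- enum {: 'I_n * 'I_m} | rank (r p.1) p.2 \in queried_ranks n m].

(** The pairs of agent [a] inject by rank into [queried_ranks n m], whose length is the bound. *)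
Lemma count_queried_pairs a :
  (count (fun p => p.1 == a) queried_pairs <= n + (trunc_log 2 m).+1)%N.
Proof.
have -> : (n + (trunc_log 2 m).+1)%N = size (queried_ranks n m).
  by rewrite size_cat size_map !size_iota.
rewrite -size_filter -(size_map (fun p => rank (r a) p.2)).
apply: uniq_leq_size.
  rewrite map_inj_in_uniq; first by do 2!apply: filter_uniq; exact: enum_uniq.
  move=> [i g] [j h]; rewrite !mem_filter /= => /andP[/eqP-> _] /andP[/eqP-> _].
  by move/rank_inj->.
move=> p /mapP[[i g]]; rewrite !mem_filter /= => /andP[/eqP-> /andP[gq _]] ->.
exact: gq.
Qed.

Definition allocation_of (owner : 'I_m -> 'I_n) : allocation n m.
Proof.
exists (fun i => [set g | owner g == i]).
  move=> i j neq_ij; rewrite -setI_eq0; apply/eqP/setP => g; rewrite !inE.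
  by apply/negP => /andP[/eqP-> /eqP]; apply/eqP.
by apply/setP => g; rewrite inE; apply/bigcupP; exists (owner g); rewrite ?inE.
Defined.

(** One allocation serves all valuations compatible with the answers, so it can be output knowing
    only these. *)
Lemma draft_EFX (R : realType) (u : 'I_n -> 'I_m -> R) : (0 < n)%N ->
  exists X : allocation n m, forall v,
    (forall i, compatible r i (u i) (v i)) -> EFX (9 * n%:R)^-1 v X.
Proof.
move=> n_gt0; have [|||owner _ own] := draft r u (s := enum 'I_n) (S := setT).
- by rewrite -size_eq0 size_enum_ord -lt0n.
- exact: enum_uniq.
- by rewrite size_enum_ord setCT cards0 addn0.
exists (allocation_of owner) => v cv i j neq_ij _ g gj.
have v0 h : 0 <= v i h by case: (cv i).
have bundleE k : allocation_of owner k = [set h in setT | owner h == k].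
  by apply/setP => h; rewrite !inE.
have [|] := own i j (mem_enum _ i) (mem_enum _ j) neq_ij; rewrite -?bundleE.
  (* Removing [g] from a singleton leaves nothing to envy. *)
  rewrite (cardsD1 g) gj ltnS leqn0 cards_eq0 => /eqP eq0.
  by rewrite /bundle_value eq0 big_set0 mulr0 sumr_ge0.
move=> /(_ _ (cv i)) le; rewrite ler_pdivrMl ?mulr_gt0 ?ltr0n //.
have sumE k : bundle_value (v i) (allocation_of owner k) =
              \sum_(h in setT | owner h == k) v i h.
  by apply: eq_bigl => h; rewrite !inE.
rewrite -!sumE in le; apply: le_trans le.
by rewrite {2}/bundle_value (big_setD1 g gj) lerDr.
Qed.

End Algorithm.

Theorem corollary4p5 (R : realType) (n : nat) (hn : (2 <= n)%N) :
  exists c C : R, [/\ 0 < c, 0 < C &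
    forall m : nat, (n <= m)%N ->
    exists A : algorithm R n m, forall I : instance R n m,
      (queries_per_agent A I)%:R <= C * ln m%:R /\
      EFX (c / Num.sqrt (ln m%:R)) (@valuation R n m I) (outcome A I)].
Proof.
have n_gt0 : (0 < n)%N by apply: ltnW.
have ln2_gt0 : 0 < ln 2 :> R by rewrite ln_gt0 // ltr1n.
(* As [m >= 2], the factor [sqrt (ln 2) / sqrt (ln m)] is at most 1, so the required ratio is at
   most [1 / (9 n)]. Likewise [log2 m >= 1] bounds [n + 1 + log2 m] by [(n + 2) * log2 m]. *)
exists ((9 * n%:R)^-1 * Num.sqrt (ln 2)), (n.+2%:R / ln 2); split.
- by rewrite mulr_gt0 ?invr_gt0 ?mulr_gt0 ?sqrtr_gt0 ?ltr0n.
- by rewrite divr_gt0 ?ltr0n.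
move=> m le_nm; have le2m : (2 <= m)%N by apply: leq_trans le_nm.
have m_gt0 : (0 < m)%N by apply: ltnW.
have ln_le (p : nat) : (0 < p)%N -> (p <= m)%N -> ln p%:R <= ln m%:R :> R.
  by move=> p_gt0 le_pm; rewrite ler_ln ?posrE ?ltr0n // ler_nat.
have lnm_gt0 : 0 < ln m%:R :> R by apply: lt_le_trans ln2_gt0 (ln_le 2 _ _).
(* Choice turns the existence of an allocation into a function of rankings and answers. *)
have [F FP] := choice (fun ru : ('I_n -> ranking m) * ('I_n -> 'I_m -> R) =>
  draft_EFX ru.1 ru.2 n_gt0).
exists (fun r => query_all (queried_pairs r) (fun u => F (r, u))) => I; split.
  apply: (@le_trans _ _ (n + (trunc_log 2 m).+1)%:R).
    rewrite ler_nat; apply/bigmax_leqP => a _.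
    by rewrite num_queries_query_all count_queried_pairs.
  have : (trunc_log 2 m)%:R * ln 2 <= ln m%:R :> R.
    rewrite mulr_natl -lnXn ?ltr0n // -natrX ln_le ?expn_gt0 //.
    exact: trunc_logP.
  rewrite mulrAC ler_pdivlMr //; have := ler_wpM2l (ler0n R n.+1) (ln_le 2 isT le2m).
  move: (ln 2) (ln m%:R) => L Lm; rewrite natrD -!natr1; lra.
set v := @valuation R n m I; set r := @rankings R n m I.
rewrite /outcome; have [u -> uv] := run_query_all v (queried_pairs r) (fun u => F (r, u)).
have Xefx := FP (r, u) v; move: Xefx => /= Xefx.
move=> i j neq_ij Xj g gj.
apply: le_trans (Xefx _ i j neq_ij Xj g gj); last first.
  move=> k; split; [exact: rankings_consistent | exact: valuation_ge0 |].
  by move=> h hq; apply: uv; rewrite mem_filter mem_enum hq.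
apply: ler_wpM2r; first by apply: sumr_ge0 => h _; exact: valuation_ge0.
rewrite -mulrA ler_piMr ?invr_ge0 ?mulr_ge0 // ler_pdivrMr ?sqrtr_gt0 // mul1r.
by rewrite ler_wsqrtr // ln_le.
Qed.
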